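(* Let $n,t$ be integers with $2\le t\le n-1$ and let $G_t(x)=x^{2^t-1}$ over $\mathbb{F}_{2^n}$. Then $$G_t(x+1)+G_t(x)+1=\frac{(x^{2^{t-1}}+x)^2}{x^2+x}$$ (as an identity of rational functions in $x$). Consequently, for any $b\in\mathbb{F}_{2^n}\setminus\{1\}$, $\delta(b)$ is the number of roots in $\mathbb{F}_{2^n}\setminus\mathbb{F}_2$ of the linear polynomial $$P_b(x)=x^{2^t}+bx^2+(b+1)x .$$ Moreover, $$\delta(0)=2^{\gcd(t,n)}-2,\qquad \delta(1)=2^{\gcd(t-1,n)},$$ and for any $b\in\mathbb{F}_{2^n}\setminus\mathbb{F}_2$ one has $\delta(b)=2^r-2$ for some integer $r$ (depending on $b$) with $1\le r\le\min(t,n-t+1)$.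
   Context: For $b\in\mathbb{F}_{2^n}$, $\delta(b)=\#\{x\in\mathbb{F}_{2^n} : G_t(x+1)+G_t(x)=b\}$. *)

(* Defs.v *)
From HB Require Import structures.
From mathcomp Require Import all_boot all_order all_algebra.

Set Implicit Arguments.
Unset Strict Implicit.
Unset Printing Implicit Defensive.

Import GRing.Theory.
Local Open Scope ring_scope.

(* G_t is kept as a polynomial, so that one object serves both for the identity
   of rational functions and, through evaluation, for the power map on F. *)
Definition G (F : finFieldType) (t : nat) : {poly F} := 'X^(2 ^ t - 1).

Definition delta (F : finFieldType) (t : nat) (b : F) : nat :=
  #|[set x : F | (G F t).[x + 1] + (G F t).[x] == b]|.

Definition P (F : finFieldType) (t : nat) (b : F) : {poly F} :=
  'X^(2 ^ t) + b *: 'X^2 + (b + 1) *: 'X.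

(* The copy of F_2 inside F, meaningful when F has characteristic 2. *)
Definition F2 (F : finFieldType) : {set F} := [set 0; 1].

(* Main.v *)
(** Outside F_2, multiplying G_t(x+1) + G_t(x) = b by x^2 + x turns it into
    P_b(x) = 0. The roots of P_b form an additive group containing F_2, hence
    number 2^r with r >= 1; the degree of P_b gives r <= t, and the degree of
    its (n-t)-th Frobenius twist, reduced by x^(2^n) = x, gives r <= n - t + 1.
    For b = 0 and b = 1 the equation says that x is fixed by the t-th,
    respectively (t-1)-th, power of the Frobenius. *)

Require Import Defs.
From HB Require Import structures.
From mathcomp Require Import all_boot all_order all_algebra.
From mathcomp Require Import fingroup finfield ring zify.

Set Implicit Arguments.
Unset Strict Implicit.
Unset Printing Implicit Defensive.

Import GRing.Theory.
Local Open Scope ring_scope.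

Lemma exprD_pchar2 (R : comNzRingType) (char2 : 2 \in [pchar R]) (x y : R) k :
  (x + y) ^+ (2 ^ k) = x ^+ (2 ^ k) + y ^+ (2 ^ k).
Proof. by rewrite exprDn_pchar // pnatX pnatE ?char2. Qed.

(** With [a] and [c] the powers of [y + 1] and [y], additivity of the Frobenius gives
    [a * (y + 1) = c * y + 1], and the rest is expansion. A general ring allows both [y = 'X] and
    [y] in the field. *)
Lemma power_derivative_mul (R : comNzRingType) (char2 : 2 \in [pchar R])
    (y : R) t : (0 < t)%N ->
  ((y + 1) ^+ (2 ^ t - 1) + y ^+ (2 ^ t - 1) + 1) * (y ^+ 2 + y)
    = (y ^+ (2 ^ (t - 1)) + y) ^+ 2.
Proof.
move=> t_gt0.
have expS z : z ^+ (2 ^ t) = z ^+ (2 ^ t - 1) * z :> R.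
  by rewrite -exprSr subn1 prednK ?expn_gt0.
have := exprD_pchar2 char2 y 1 t; rewrite expr1n !expS => y1E.
rewrite (exprD_pchar2 char2 _ _ 1) expn1 -exprM -expnSr (subn1 t) prednK // expS.
move: (_ ^+ (2 ^ t - 1)) (y ^+ (2 ^ t - 1)) y1E => a c y1E.
have -> : (a + c + 1) * (y ^+ 2 + y)
    = a * (y + 1) * y + (c * y ^+ 2 + c * y + y ^+ 2 + y) by ring.
rewrite y1E.
have -> : (c * y + 1) * y + (c * y ^+ 2 + c * y + y ^+ 2 + y)
    = c * y + y ^+ 2 + (c * y ^+ 2 + y) *+ 2 by ring.
by rewrite mulrn_pchar ?addr0.
Qed.

Lemma size_XnsubX (R : nzRingType) m :
  (1 < m)%N -> size ('X^m - 'X : {poly R}) = m.+1.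
Proof. by move=> m_gt1; rewrite size_polyDl ?size_polyN ?size_polyX size_polyXn. Qed.

(** After removing a factor ['X], this is the divisibility of [Y^d - 1] by [Y - 1] at [Y = 'X^m]. *)
Lemma dvdp_XnsubX (R : idomainType) m k : (0 < m)%N -> (0 < k)%N ->
  (m.-1 %| k.-1)%N -> ('X^m - 'X : {poly R}) %| 'X^k - 'X.
Proof.
case: m k => [|m] [|k] //= _ _ /dvdnP [d ->].
have XnE i : 'X^(i.+1) - 'X = 'X * ('X^i - 1) :> {poly R}.
  by rewrite exprS mulrBr mulr1.
by rewrite !XnE dvdp_mul2l ?polyX_eq0 // mulnC exprM [in X in _ %| X]subrX1 dvdp_mulIl.
Qed.

(** The polynomial ['X^#|F| - 'X] is the product of ['X - x] over all [x] in [F], so its divisors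
    split with distinct roots. *)
Lemma card_root_dvdp (F : finFieldType) (p : {poly F}) :
  p %| 'X^#|F| - 'X -> #|[set x | root p x]| = (size p).-1.
Proof.
rewrite finField_genPoly => /dvdp_prod_XsubC [m p_eq].
rewrite (eqp_size p_eq) size_prod_XsubC /=.
have/card_uniqP <- : uniq (mask m (index_enum F)).
  by rewrite mask_uniq // index_enum_uniq.
by apply: eq_card => x; rewrite inE (eqp_root p_eq) root_prod_XsubC.
Qed.

Lemma iter_exprX (R : pzSemiRingType) (x : R) q k j :
  x ^+ (q ^ k) = x -> x ^+ (q ^ (j * k)) = x.
Proof.
move=> xE; elim: j => [|j IHj]; first by rewrite mul0n expn0 expr1.
by rewrite mulSn expnD exprM xE.
Qed.

Lemma card_fixed_exprX (F : finFieldType) q n k :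
    #|F| = (q ^ n)%N -> (0 < k)%N ->
  #|[set x : F | x ^+ (q ^ k) == x]| = (q ^ gcdn k n)%N.
Proof.
move=> cardF k_gt0; set g := gcdn k n.
have cardF_gt1 : (1 < q ^ n)%N by rewrite -cardF finNzRing_gt1.
have n_gt0 : (0 < n)%N by case: (n) cardF_gt1.
have q_gt1 : (1 < q)%N.
  by case: (q) cardF_gt1 => [|[]] //; rewrite ?exp0n ?exp1n.
have g_gt0 : (0 < g)%N by rewrite gcdn_gt0 k_gt0.
have qg_gt1 : (1 < q ^ g)%N by rewrite -(exp1n g) ltn_exp2r.
have -> : [set x : F | x ^+ (q ^ k) == x]
    = [set x | root ('X^(q ^ g) - 'X) x].
  apply/setP=> x; rewrite !inE rootE !hornerE subr_eq0.
  have xn : x ^+ (q ^ n) = x by rewrite -cardF expf_card.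
  apply/eqP/eqP=> [xk|xg]; last first.
    by rewrite -(divnK (dvdn_gcdl k n)) iter_exprX.
  (* Bezout: [u * k = v * n + g], and both [x ^+ (q ^ (u * k))] and [x ^+ (q ^ (v * n))] equal
     [x]. *)
  have [u v uvE _] := egcdnP n k_gt0.
  by have := iter_exprX u xk; rewrite uvE expnD exprM iter_exprX.
rewrite card_root_dvdp ?size_XnsubX //.
rewrite cardF dvdp_XnsubX ?expn_gt0 ?(ltnW q_gt1) //.
by rewrite -(divnK (dvdn_gcdr k n)) mulnC expnM dvdn_pred_predX.
Qed.

(** By finiteness [S] is an additive subgroup, so Lagrange applies. *)
Lemma card_additive_closed (F : finFieldType) p n (S : {set F}) :
    prime p -> #|F| = (p ^ n)%N ->
    0 \in S -> {in S & S, forall x y, x + y \in S} ->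
  exists r, #|S| = (p ^ r)%N.
Proof.
move=> p_pr cardF S0 SD.
have groupS : group_set S by apply/group_setP.
have := cardSg (subsetT (Group groupS)); rewrite cardsT cardF /=.
by case/(dvdn_pfactor _ _ p_pr) => r _ ->; exists r.
Qed.

Lemma card_root_lt_size (F : finFieldType) (p : {poly F}) (S : {set F}) :
  p != 0 -> {in S, forall x, root p x} -> (#|S| < size p)%N.
Proof.
move=> p_neq0 rootS; rewrite cardE max_poly_roots ?enum_uniq //.
by apply/allP => x; rewrite mem_enum => /rootS.
Qed.

Section Char2.

Variables (F : finFieldType) (t : nat).
Hypotheses (char2 : 2 \in [pchar F]) (t_gt0 : (0 < t)%N).

Lemma P_horner (b x : F) :
  (P t b).[x] = x ^+ (2 ^ t) + b * x ^+ 2 + (b + 1) * x.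
Proof. by rewrite !hornerE. Qed.

Lemma F2_sqrD (x : F) : (x \in F2 F) = (x ^+ 2 + x == 0).
Proof.
rewrite !inE expr2 -{5}[x]mulr1 -mulrDr mulf_eq0.
by rewrite -{2}(oppr_pchar2 char2 1) subr_eq0.
Qed.

(** Hence 0 and 1 are counted by [delta t 1] and by no other [delta t b]. *)
Lemma G_diff_F2 (x : F) : x \in F2 F -> (G F t).[x + 1] + (G F t).[x] = 1.
Proof.
have m_neq0 : (2 ^ t - 1 == 0)%N = false.
  by rewrite subn_eq0 leqNgt -{1}(expn0 2) ltn_exp2l // t_gt0.
rewrite !inE !hornerXn => /orP[] /eqP ->.
  by rewrite add0r expr1n expr0n m_neq0 addr0.
by rewrite addrr_pchar2 // expr1n expr0n m_neq0 add0r.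
Qed.

Lemma G_diff_eq_root (b x : F) :
  x \notin F2 F ->
  ((G F t).[x + 1] + (G F t).[x] == b) = root (P t b) x.
Proof.
rewrite F2_sqrD => x_neq0; rewrite !hornerXn rootE P_horner.
have := power_derivative_mul char2 x t_gt0.
rewrite (exprD_pchar2 char2 _ _ 1) -exprM -expnSr (subn1 t) prednK //.
move=> derE; rewrite -(inj_eq (addIr 1)) -(inj_eq (mulIf x_neq0)) derE.
rewrite -subr_eq0 (oppr_pchar2 char2) expn1.
congr (_ == _).
(* The two sides differ by [x ^+ 2 *+ 2], which is zero. *)
rewrite -[RHS]addr0 -(mulrn_pchar char2 (x ^+ 2)); ring.
Qed.

Lemma delta_neq1 (b : F) : b != 1 ->
  delta t b = #|[set x in ~: F2 F | root (P t b) x]|.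
Proof.
move=> b_neq1; apply: eq_card => x; rewrite inE [in RHS]inE inE.
case: (boolP (x \in F2 F)) => [/G_diff_F2 ->|/G_diff_eq_root <-] //=.
by rewrite eq_sym (negbTE b_neq1).
Qed.

Lemma F2_sub_root (b x : F) : x \in F2 F -> root (P t b) x.
Proof.
rewrite rootE P_horner !inE => /orP[] /eqP->.
  by rewrite !expr0n expn_eq0 !mulr0 !addr0.
by rewrite !expr1n !mulr1 [1 + b]addrC addrr_pchar2.
Qed.

Lemma card_F2 : #|F2 F| = 2%N.
Proof. by rewrite cards2 eq_sym oner_eq0. Qed.

Lemma delta_card_root (b : F) : b != 1 ->
  delta t b = (#|[set x | root (P t b) x]| - 2)%N.
Proof.
move=> /delta_neq1 ->; rewrite -card_F2 -cardsDS.
  by apply: eq_card => x; rewrite !inE.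
by apply/subsetP => x; rewrite [in X in _ -> X]inE; apply: F2_sub_root.
Qed.

End Char2.

Lemma P_rootD (F : finFieldType) t (b x y : F) : 2 \in [pchar F] ->
  root (P t b) x -> root (P t b) y -> root (P t b) (x + y).
Proof.
move=> char2; rewrite !rootE !P_horner => /eqP xE /eqP yE.
rewrite exprD_pchar2 // (exprD_pchar2 char2 _ _ 1) expn1; apply/eqP.
by rewrite -[RHS]addr0 -{1}xE -yE; ring.
Qed.

Theorem theorem1 (n t : nat) (F : finFieldType) (cardF : #|F| = (2 ^ n)%N)
    (t_ge2 : (2 <= t)%N) (t_le : (t <= n - 1)%N) :
  [/\ tofrac (G F t \Po ('X + 1)) + tofrac (G F t) + 1
        = tofrac ('X^(2 ^ (t - 1)) + 'X) ^+ 2 / tofrac ('X^2 + 'X)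
          :> {fraction {poly F}},
      forall b : F, b != 1 ->
        delta t b = #|[set x in ~: F2 F | root (P t b) x]|,
      delta t (0 : F) = (2 ^ gcdn t n - 2)%N,
      delta t (1 : F) = (2 ^ gcdn (t - 1) n)%N
    & forall b : F, b \notin F2 F ->
        exists r : nat,
          (1 <= r <= minn t (n - t + 1))%N /\ delta t b = (2 ^ r - 2)%N].
Proof.
have char2 : 2 \in [pchar F] by apply: card_finPcharP cardF _.
have t_gt0 : (0 < t)%N by apply: ltnW.
split.
- have den_neq0 : tofrac ('X^2 + 'X : {poly F}) != 0.
    rewrite tofrac_eq0 -size_poly_eq0 size_polyDl size_polyXn //.
    by rewrite size_polyX.
  apply: (mulIf den_neq0); rewrite divfK // comp_Xn_poly.
  rewrite -(rmorph1 (@tofrac _)) -!rmorphD -rmorphM -rmorphXn.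
  by rewrite power_derivative_mul // pchar_poly.
- by move=> b; apply: delta_neq1.
- rewrite delta_card_root // 1?eq_sym ?oner_eq0 //.
  rewrite -(card_fixed_exprX cardF t_gt0); congr (_ - _)%N.
  apply: eq_card => x; rewrite !inE rootE P_horner mul0r addr0 add0r mul1r.
  by rewrite -{2}(oppr_pchar2 char2 x) subr_eq0.
- have t1_gt0 : (0 < t - 1)%N by rewrite subn_gt0.
  rewrite -(card_fixed_exprX cardF t1_gt0); apply: eq_card => x.
  rewrite inE [in RHS]inE; case: (boolP (x \in F2 F)) => [xF2|x_nF2].
    rewrite G_diff_F2 // eqxx; move: xF2; rewrite !inE => /orP[] /eqP ->.
      by rewrite expr0n expn_eq0 eqxx.
    by rewrite expr1n eqxx.
  (* For [b = 1] the value of [P] at [x] is the square of [x ^+ (2 ^ (t - 1)) + x], and a square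
     vanishes only with its base. *)
  rewrite G_diff_eq_root // rootE P_horner (addrr_pchar2 char2) mul0r addr0.
  rewrite mul1r -[RHS]subr_eq0 (oppr_pchar2 char2).
  rewrite -[RHS](sqrf_eq0) (exprD_pchar2 char2 _ _ 1) -exprM -expnSr.
  by rewrite (subn1 t) prednK.
- move=> b; rewrite !inE negb_or => /andP[b_neq0 b_neq1].
  rewrite delta_card_root //; set S := [set x | _].
  have [r cardS] : exists r, #|S| = (2 ^ r)%N.
    apply: (card_additive_closed _ cardF) => //.
      by rewrite inE F2_sub_root // !inE eqxx.
    by move=> x y; rewrite !inE; apply: P_rootD.
  exists r; split; last by rewrite cardS.
  have r_gt0 : (1 <= r)%N.
    rewrite -(@leq_exp2l 2) // -cardS expn1 -(card_F2 F).
    by apply/subset_leq_card/subsetP => x xF2; rewrite inE F2_sub_root.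
  (* The size of a polynomial is its degree plus one, so each bound on [r] becomes a bound on the
     number of roots. *)
  have le_exp k : (r <= k)%N = (#|S| < (2 ^ k).+1)%N.
    by rewrite ltnS cardS leq_exp2l.
  rewrite r_gt0 leq_min !le_exp /=; apply/andP; split.
    have sizeP : size (P t b) = (2 ^ t).+1.
      rewrite /P -addrA size_polyDl size_polyXn //.
      (* Since [t >= 2], the quadratic term cannot meet the leading one. *)
      have t_exp : (2 ^ 1 < 2 ^ t)%N by rewrite ltn_exp2l.
      apply: leq_ltn_trans (size_polyD _ _) _.
      rewrite gtn_max !(leq_ltn_trans (size_scale_leq _ _)) //.
        by rewrite size_polyX ltnS; apply: ltnW.
      by rewrite size_polyXn ltnS.
    rewrite -sizeP; apply: card_root_lt_size => [|x]; last by rewrite inE.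
    by rewrite -size_poly_eq0 sizeP.
  (* Raising P_b(x) = 0 to the power 2 ^ (n - t) turns the leading term into
     x ^ (2 ^ n) = x, leaving an equation of degree 2 ^ (n - t + 1). *)
  pose c := b ^+ (2 ^ (n - t)).
  (* Here [b != 0] ensures that [Q] has the expected degree. *)
  have c_neq0 : c != 0 by rewrite expf_neq0.
  pose Q : {poly F} :=
    c *: 'X^(2 ^ (n - t + 1)) + ((c + 1) *: 'X^(2 ^ (n - t)) + 'X).
  have sizeQ : size Q = (2 ^ (n - t + 1)).+1.
    have nt_exp : (2 ^ 0 < 2 ^ (n - t + 1))%N by rewrite ltn_exp2l // addn1.
    rewrite /Q size_polyDl size_scale // size_polyXn //.
    apply: leq_ltn_trans (size_polyD _ _) _.
    rewrite gtn_max (leq_ltn_trans (size_scale_leq _ _)).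
      by rewrite size_polyX ltnS.
    by rewrite size_polyXn ltnS ltn_exp2l // addn1.
  rewrite -sizeQ; apply: card_root_lt_size => [|x].
    by rewrite -size_poly_eq0 sizeQ.
  rewrite inE !rootE P_horner => /eqP xE.
  have := congr1 (fun y => y ^+ (2 ^ (n - t))) xE.
  rewrite !exprD_pchar2 // !exprMn -!exprM -expnD.
  rewrite exprD_pchar2 // expr1n -/c subnKC; last by lia.
  rewrite -cardF expf_card expr0n expn_eq0 /= => xE'.
  (* The target zero is replaced by the twisted equation, leaving a reordering of terms. *)
  rewrite !hornerE /= addn1 expnSr [x ^+ (_ * 2)]exprM -[eqbRHS]xE'.
  by apply/eqP; ring.
Qed.
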